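(* Assume that $J$ is coercive, i.e. $J(\alpha)\to+\infty$ as $\|\alpha\|\to+\infty$. Consider the problem $(\mathsf P_{\lambda,\psi})$: minimize $J(\alpha)$ over $\alpha\in\mathbb R^L$. 1. (Existence) $(\mathsf P_{\lambda,\psi})$ has at least one solution. 2. (Uniqueness) $(\mathsf P_{\lambda,\psi})$ has a unique solution if either $\Phi$ is an orthobasis and $\ker(\mathrm H)=\{0\}$, or $\psi$ is strictly convex.
   Context: Let $n,L$ be positive integers with $L\ge n$. $\mathbb R^n$ is the space of images (indexed by a two-dimensional periodic pixel grid and written as vectors) and $\mathbb R^L$ the space of coefficients, both with the Euclidean inner product and norm $\|\cdot\|$. Convolution: $h$ is a nonzero point spread function with nonnegative entries, and $\mathrm H:\mathbb R^n\to\mathbb R^n$, $\mathrm Hx=h\circledast x$, is circular convolution with $h$. Dictionary: $\Phi\in\mathbb R^{n\times L}$ has columns of unit $\ell_2$-norm and is either an orthobasis ($L=n$, $\Phi^{\mathrm T}\Phi=\Phi\Phi^{\mathrm T}=\mathrm I$, in which case $c=1$) or a tight frame with constant $c>0$ ($\Phi\Phi^{\mathrm T}=c\,\mathrm I$). Data: $y=(y_i)_{1\le i\le n}$ are observed counts (nonnegative integers), and $z_i=2\sqrt{y_i+3/8}$. Data fidelity: $F(\eta)=\sum_{i=1}^n f_{(i)}(\eta_i)$ with $f_{(i)}(s)=\tfrac12\left(z_i-2\sqrt{s+3/8}\right)^2$, and $f_1(\alpha)=F(\mathrm H\Phi\alpha)$, defined for those $\alpha$ with $(\mathrm H\Phi\alpha)_i>-3/8$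 for all $i$. Regularization: $\lambda>0$, $\psi:\mathbb R\to\mathbb R$ is convex, $\mathcal C=[0,+\infty)^n$, $\mathcal C'=\{\alpha\in\mathbb R^L:\Phi\alpha\in\mathcal C\}$, and $f_2(\alpha)=\imath_{\mathcal C'}(\alpha)+\lambda\sum_{i=1}^L\psi(\alpha_i)$, where $\imath_{\mathcal C'}$ is $0$ on $\mathcal C'$ and $+\infty$ elsewhere. Objective: $J=f_1+f_2:\mathbb R^L\to(-\infty,+\infty]$, with the convention $J(\alpha)=+\infty$ for $\alpha\notin\mathcal C'$. Since $h\ge0$, $\mathrm H\Phi\alpha\ge0$ for $\alpha\in\mathcal C'$, so $f_1$ is defined on $\mathcal C'$. *)

(* Defs.v *)
From HB Require Import structures.
From mathcomp Require Import all_boot all_order all_algebra.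
From mathcomp Require Import all_classical all_reals.
From mathcomp Require Import ereal interval_inference convex.

Set Implicit Arguments.
Unset Strict Implicit.
Unset Printing Implicit Defensive.

Import Order.TTheory GRing.Theory Num.Theory.

Local Open Scope classical_set_scope.
Local Open Scope convex_scope.
Local Open Scope ring_scope.

(* The norm provided by the library on matrices is the sup norm. *)
Definition enorm (R : realType) (n : nat) (v : 'cV[R]_n) : R :=
  Num.sqrt (\sum_i v i 0 ^+ 2).

(* [i - k] and [j - l] are taken in the cyclic groups ['I_n1.+1] and
   ['I_n2.+1], which makes the pixel grid periodic. *)
Definition circ_conv (R : realType) (n1 n2 : nat) (h x : 'M[R]_(n1.+1, n2.+1)) :
    'M[R]_(n1.+1, n2.+1) :=
  \matrix_(i, j) \sum_k \sum_l h k l * x (i - k) (j - l).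

(* An image with n1.+1 x n2.+1 pixels is written as a vector row by row. *)
Definition conv_op (R : realType) (n1 n2 : nat) (h : 'M[R]_(n1.+1, n2.+1))
    (x : 'cV[R]_(n1.+1 * n2.+1)) : 'cV[R]_(n1.+1 * n2.+1) :=
  (mxvec (circ_conv h (vec_mx x^T)))^T.

Definition ker (U V : nmodType) (f : U -> V) : set U := [set x | f x = 0].

Definition orthobasis (R : realType) (n L : nat) (Phi : 'M[R]_(n, L)) : Prop :=
  [/\ L = n, Phi^T *m Phi = 1%:M & Phi *m Phi^T = 1%:M].

Definition tight_frame (R : realType) (n L : nat) (c : R)
    (Phi : 'M[R]_(n, L)) : Prop :=
  0 < c /\ Phi *m Phi^T = c%:M.

Definition anscombe (R : realType) (k : nat) : R :=
  2 * Num.sqrt (k%:R + 3 / 8).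

(* [Num.sqrt] vanishes on negative numbers, so the functions below are total;
   only their values at arguments above - 3 / 8 are meaningful. *)
Definition fidelity1 (R : realType) (z s : R) : R :=
  2^-1 * (z - 2 * Num.sqrt (s + 3 / 8)) ^+ 2.

Definition fidelity (R : realType) (n : nat) (y : 'I_n -> nat)
    (eta : 'cV[R]_n) : R :=
  \sum_i fidelity1 (anscombe R (y i)) (eta i 0).

Definition f1 (R : realType) (n1 n2 L : nat) (h : 'M[R]_(n1.+1, n2.+1))
    (Phi : 'M[R]_(n1.+1 * n2.+1, L)) (y : 'I_(n1.+1 * n2.+1) -> nat)
    (alpha : 'cV[R]_L) : R :=
  fidelity y (conv_op h (Phi *m alpha)).

Definition nneg_orthant (R : realType) (n : nat) : set 'cV[R]_n :=
  [set x | forall i, 0 <= x i 0].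

Definition feasible (R : realType) (n L : nat) (Phi : 'M[R]_(n, L)) :
    set 'cV[R]_L :=
  [set alpha | nneg_orthant (Phi *m alpha)].

(* The indicator function of convex analysis, with values 0 and +oo; [\1_A] of
   the library takes the values 1 and 0. *)
Definition cvx_indicator (R : realType) (T : Type) (A : set T) (x : T) : \bar R :=
  if x \in A then 0%E else +oo%E.

Definition f2 (R : realType) (n L : nat) (Phi : 'M[R]_(n, L)) (lambda : R)
    (psi : R -> R) (alpha : 'cV[R]_L) : \bar R :=
  (cvx_indicator R (feasible Phi) alpha +
   (lambda * \sum_i psi (alpha i 0))%:E)%E.

(* Outside [feasible Phi] the value is +oo, whatever the value of [f1]. *)
Definition objective (R : realType) (n1 n2 L : nat) (h : 'M[R]_(n1.+1, n2.+1))
    (Phi : 'M[R]_(n1.+1 * n2.+1, L)) (y : 'I_(n1.+1 * n2.+1) -> nat)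
    (lambda : R) (psi : R -> R) (alpha : 'cV[R]_L) : \bar R :=
  ((f1 h Phi y alpha)%:E + f2 Phi lambda psi alpha)%E.

Definition coercive (R : realType) (L : nat) (J : 'cV[R]_L -> \bar R) : Prop :=
  forall M : R, exists r : R, forall alpha, r < enorm alpha -> (M%:E < J alpha)%E.

Definition is_minimizer (R : realType) (T : Type) (J : T -> \bar R) (a : T) :
    Prop :=
  forall b, (J a <= J b)%E.

(* The strict counterpart of the library's [convex_function]. *)
Definition strictly_convex_function (R : numFieldType) (E : lmodType R)
    (E' := convex_lmodType E) (D : set E') (f : E' -> R^o) : Prop :=
  forall t : {i01 R}, 0 < t%:num -> t%:num < 1 ->
    {in D &, forall x y : E', x != y -> f (x <| t |> y) < f x <| t |> f y}.

(* Main.v *)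
(* J is finite exactly on the closed convex set C' (which contains 0), where it
   equals the continuous function f1 + lambda * sum psi; a convex psi is
   locally Lipschitz, hence continuous.  By coercivity the sublevel set of J
   at level J 0 is compact, so J attains its minimum there.

   For s > - 3/8, (z - 2 sqrt (s + 3/8))^2 / 2 is affine in s minus
   2 z sqrt (s + 3/8), hence strictly convex because z = 2 sqrt (y_i + 3/8) is
   positive.  So f1 is strictly convex along any two points with distinct images
   under H Phi, and two distinct minimizers would be beaten by their midpoint
   whenever H Phi is injective or psi is strictly convex. *)
Require Import Defs.
From HB Require Import structures.
From mathcomp Require Import all_boot all_order all_algebra.
From mathcomp Require Import all_classical all_reals.
From mathcomp Require Import ereal interval_inference convex.
From mathcomp Require Import topology normedtype derive realfun.
From mathcomp Require Import ring lra.

Set Implicit Arguments.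
Unset Strict Implicit.
Unset Printing Implicit Defensive.

Import Order.TTheory GRing.Theory Num.Theory.
Import numFieldNormedType.Exports.

Local Open Scope classical_set_scope.
Local Open Scope ring_scope.

(** * Strict inequalities and continuity for finite sums *)

Lemma ltr_sum_ex (R : numDomainType) (I : finType) (F G : I -> R) :
  (forall i, F i <= G i) -> (exists i, F i < G i) ->
  \sum_i F i < \sum_i G i.
Proof.
move=> FG [i FGi]; rewrite (bigD1 i)//= [X in _ < X](bigD1 i)//=.
by apply: ltr_leD => //; exact: ler_sum.
Qed.

Lemma cV_neq_coord (T : eqType) n (v w : 'cV[T]_n) :
  v != w -> exists i, v i 0 != w i 0.
Proof.
move=> vw; apply/existsP; apply: contra_neqT vw.
by rewrite negb_exists => /forallP vw; apply/colP => i; exact/eqP/negPn.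
Qed.

Lemma continuous_sumr (R : realType) (T : topologicalType) n
    (F : 'I_n -> T -> R) :
  (forall i, continuous (F i)) -> continuous (fun x => \sum_i F i x).
Proof.
by move=> F_cont; apply: continuous_big => [|i _]; [exact: add_continuous|].
Qed.

(** * Convex functions of a real variable *)

Section convex_real.
Variable R : realType.
Implicit Types (psi : R -> R) (s t x y : R).

Lemma convex_functionE psi : convex_function (E := R^o) setT psi ->
  forall t x y, 0 <= t <= 1 ->
    psi (t * x + (1 - t) * y) <= t * psi x + (1 - t) * psi y.
Proof.
move=> psi_cvx t x y /andP[t0 t1].
by apply: (psi_cvx (Itv01 t0 t1) x y); rewrite inE.
Qed.

Lemma convex_function_midpoint psi : convex_function (E := R^o) setT psi ->
  forall x y, psi (2^-1 * (x + y)) <= 2^-1 * (psi x + psi y).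
Proof.
move=> psi_cvx x y; have := convex_functionE psi_cvx x y (t := 2^-1).
have -> : 2^-1 * x + (1 - 2^-1) * y = 2^-1 * (x + y) by field.
by move=> /(_ _)/le_trans; apply; lra.
Qed.

Lemma strictly_convex_function_midpoint psi :
  strictly_convex_function (E := R^o) setT psi ->
  forall x y, x != y -> psi (2^-1 * (x + y)) < 2^-1 * (psi x + psi y).
Proof.
move=> psi_cvx x y xy.
have h0 : 0 <= 2^-1 :> R by lra.
have h1 : 2^-1 <= 1 :> R by lra.
have := psi_cvx (Itv01 h0 h1) _ _ x y (in_setT _) (in_setT _) xy.
rewrite convRE /= => psi_lt.
have -> : 2^-1 * (x + y) = 2^-1 * x + (1 - 2^-1) * y by field.
have {}psi_lt : psi (2^-1 * x + (1 - 2^-1) * y) <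
  2^-1 * psi x + (1 - 2^-1) * psi y by apply: psi_lt; lra.
by apply: lt_le_trans psi_lt _; lra.
Qed.

(** Slopes of chords issued from [x] are monotone, so up to distance 1 they lie between those
    reaching [x - 1] and [x + 1]; the sum of absolute values covers both sides. *)
Lemma convex_function_local_lipschitz psi :
  convex_function (E := R^o) setT psi ->
  forall x y, `|y - x| <= 1 ->
    `|psi y - psi x| <=
      `|y - x| * (`|psi (x + 1) - psi x| + `|psi (x - 1) - psi x|).
Proof.
move=> psi_cvx.
have bound x t d : 0 <= t <= 1 ->
    `|psi (x + t * d) - psi x| <=
      t * (`|psi (x + d) - psi x| + `|psi (x - d) - psi x|).
  move=> /andP[t0 t1].
  (* Upper bound: x + t d lies between x and x + d.  Lower bound: x is a convex
     combination of x + t d and x - d with weights 1/(1+t) and t/(1+t). *)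
  have up := convex_functionE psi_cvx (x + d) x (t := t).
  have lo := convex_functionE psi_cvx (x + t * d) (x - d) (t := (1 + t)^-1).
  have t1_gt0 : 0 < 1 + t by lra.
  have inv01 : 0 <= (1 + t)^-1 <= 1.
    by rewrite invr_ge0 (ltW t1_gt0) invf_le1//; lra.
  move: up lo => /(_ _) up /(_ inv01).
  have -> : (1 + t)^-1 * (x + t * d) + (1 - (1 + t)^-1) * (x - d) = x.
    by field; lra.
  have -> : (1 + t)^-1 * psi (x + t * d) + (1 - (1 + t)^-1) * psi (x - d) =
      (psi (x + t * d) + t * psi (x - d)) / (1 + t) by field; lra.
  rewrite ler_pdivlMr// => lo.
  have {}up : psi (x + t * d) <= t * psi (x + d) + (1 - t) * psi x.
    have -> : x + t * d = t * (x + d) + (1 - t) * x by ring.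
    by apply: up; lra.
  have p0 := normr_ge0 (psi (x + d) - psi x).
  have q0 := normr_ge0 (psi (x - d) - psi x).
  have pn := ler_norm (psi (x + d) - psi x).
  have qn := ler_norm (psi (x - d) - psi x).
  by rewrite ler_norml; apply/andP; split; nra.
move=> x y.
(* Write [y] as [x + t * d] with [t] the distance from [x] to [y] and [d] equal to -1 or 1 according
   to the sign of [y - x]. *)
have [yx yx1|yx yx1] := ler0P (y - x).
  have := bound x (- (y - x)) (- 1).
  have -> : x + - (y - x) * -1 = y by ring.
  rewrite opprK [X in _ * X]addrC; apply; lra.
have := bound x (y - x) 1.
have -> : x + (y - x) * 1 = y by ring.
apply; lra.
Qed.

Lemma convex_function_continuous psi :
  convex_function (E := R^o) setT psi -> continuous psi.
Proof.
move=> psi_cvx x; apply/cvgrPdist_lt => e e0.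
set C := `|psi (x + 1) - psi x| + `|psi (x - 1) - psi x|.
have C0 : 0 <= C by rewrite addr_ge0.
(* The bound 1 is the range of the Lipschitz estimate; [C + 1] keeps the denominator positive when
   [C] is 0. *)
have d0 : 0 < Num.min 1 (e / (C + 1)).
  by rewrite lt_min ltr01 divr_gt0// ltr_wpDl.
near=> y.
have : `|y - x| < Num.min 1 (e / (C + 1)).
  by rewrite distrC; near: y; apply: cvgr_dist_lt d0; exact: cvg_id.
rewrite lt_min ltr_pdivlMr ?ltr_wpDl// => /andP[yx1 yxe].
rewrite distrC.
apply: le_lt_trans (convex_function_local_lipschitz psi_cvx (ltW yx1)) _.
by apply: le_lt_trans yxe; rewrite ler_wpM2l// lerDl.
Unshelve. all: by end_near. Qed.

(** With p and q the two square roots, the squares of the two sides differ by (p - q)^2 / 4, which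
    is positive. *)
Lemma sqrt_midpoint_lt s t : 0 <= s -> 0 <= t -> s != t ->
  2^-1 * (Num.sqrt s + Num.sqrt t) < Num.sqrt (2^-1 * (s + t)).
Proof.
move=> s0 t0 st.
have p0 := sqrtr_ge0 s; have q0 := sqrtr_ge0 t.
have ps := sqr_sqrtr s0; have qt := sqr_sqrtr t0.
have pq : Num.sqrt s != Num.sqrt t.
  by apply: contra_neq st => pq; rewrite -ps -qt pq.
have pq2 : 0 < (Num.sqrt s - Num.sqrt t) ^+ 2.
  by rewrite exprn_even_gt0// subr_eq0.
have m0 : 0 <= 2^-1 * (Num.sqrt s + Num.sqrt t) by lra.
rewrite -[X in X < _](ger0_norm m0) -sqrtr_sqr ltr_sqrt; nra.
Qed.

End convex_real.

(** * Midpoint convexity and continuity of the data fidelity *)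

Section data_fidelity.
Variable R : realType.
Implicit Types z s t : R.

(** Once the square is expanded, the square root survives only in the cross term, so strict
    concavity of the root can be applied there. *)
Lemma fidelity1E z s : 0 <= s + 3 / 8 ->
  fidelity1 z s =
  2^-1 * z ^+ 2 - 2 * (z * Num.sqrt (s + 3 / 8)) + 2 * (s + 3 / 8).
Proof.
by move=> /sqr_sqrtr sqrE; rewrite /fidelity1; lra.
Qed.

Lemma fidelity1_midpoint_lt z s t : 0 < z -> 0 <= s -> 0 <= t -> s != t ->
  fidelity1 z (2^-1 * (s + t)) < 2^-1 * (fidelity1 z s + fidelity1 z t).
Proof.
move=> z0 s0 t0 st.
have s'0 : 0 <= s + 3 / 8 by lra.
have t'0 : 0 <= t + 3 / 8 by lra.
have st' : s + 3 / 8 != t + 3 / 8 by rewrite (inj_eq (addIr _)).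
have := sqrt_midpoint_lt s'0 t'0 st'.
have -> : 2^-1 * (s + 3 / 8 + (t + 3 / 8)) = 2^-1 * (s + t) + 3 / 8 by field.
rewrite !fidelity1E//; last lra.
rewrite -(ltr_pM2l z0) => lt_sqrt.
by lra.
Qed.

Lemma fidelity1_midpoint_le z s t : 0 < z -> 0 <= s -> 0 <= t ->
  fidelity1 z (2^-1 * (s + t)) <= 2^-1 * (fidelity1 z s + fidelity1 z t).
Proof.
move=> z0 s0 t0; have [<-|st] := eqVneq s t.
  by have -> : 2^-1 * (s + s) = s by [field]; lra.
exact/ltW/fidelity1_midpoint_lt.
Qed.

Lemma anscombe_gt0 k : 0 < anscombe R k.
Proof.
rewrite /anscombe mulr_gt0// sqrtr_gt0; have := ler0n R k; lra.
Qed.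

(** This holds on the whole line: [Num.sqrt], extended by 0 to negative numbers, is continuous
    everywhere. *)
Lemma fidelity1_continuous z : continuous (@fidelity1 R z).
Proof.
move=> s; rewrite /fidelity1.
have cv : (fun s' => z - 2 * Num.sqrt (s' + 3 / 8)) @ s -->
    z - 2 * Num.sqrt (s + 3 / 8).
  apply: cvgB; first exact: cvg_cst.
  apply: cvgM; first exact: cvg_cst.
  apply: (@cvg_comp _ _ _ (fun s' => s' + 3 / 8) (@Num.sqrt R) _
            (nbhs (s + 3 / 8))); last exact: sqrt_continuous.
  apply: cvgD; [exact: cvg_id | exact: cvg_cst].
by apply: cvgM; [exact: cvg_cst | exact: (cvgM cv cv)].
Qed.

Variables (n : nat) (y : 'I_n -> nat).
Implicit Types eta : 'cV[R]_n.

Lemma fidelity_continuous (T : topologicalType) (eta : T -> 'cV[R]_n) :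
  (forall i, continuous (fun x => eta x i 0)) ->
  continuous (fun x => fidelity y (eta x)).
Proof.
move=> eta_cont; apply: continuous_sumr => i x.
apply: (@cvg_comp _ _ _ (fun x => eta x i 0) (fidelity1 (anscombe R (y i))) _
          (nbhs (eta x i 0))); [exact: eta_cont | exact: fidelity1_continuous].
Qed.

Lemma fidelity_midpoint_le eta1 eta2 :
  nneg_orthant eta1 -> nneg_orthant eta2 ->
  fidelity y (2^-1 *: (eta1 + eta2)) <=
  2^-1 * (fidelity y eta1 + fidelity y eta2).
Proof.
move=> eta1_ge0 eta2_ge0; rewrite /fidelity -big_split mulr_sumr.
apply: ler_sum => i _; rewrite !mxE.
exact: fidelity1_midpoint_le (anscombe_gt0 _) (eta1_ge0 i) (eta2_ge0 i).
Qed.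

Lemma fidelity_midpoint_lt eta1 eta2 :
  nneg_orthant eta1 -> nneg_orthant eta2 -> eta1 != eta2 ->
  fidelity y (2^-1 *: (eta1 + eta2)) <
  2^-1 * (fidelity y eta1 + fidelity y eta2).
Proof.
move=> eta1_ge0 eta2_ge0 /cV_neq_coord[i0 neq0].
rewrite /fidelity -big_split mulr_sumr; apply: ltr_sum_ex => [i|].
  rewrite !mxE.
  exact: fidelity1_midpoint_le (anscombe_gt0 _) (eta1_ge0 i) (eta2_ge0 i).
exists i0; rewrite !mxE.
by apply: fidelity1_midpoint_lt neq0; [exact: anscombe_gt0 | |].
Qed.

End data_fidelity.

(** * Circular convolution: linearity, positivity, continuity *)

Section convolution.
Variables (R : realType) (n1 n2 : nat) (h : 'M[R]_(n1.+1, n2.+1)).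
Implicit Types x : 'cV[R]_(n1.+1 * n2.+1).

(** Every vector index is some [mxvec_index i j], so this formula in pixel coordinates gives all
    entries. *)
Lemma conv_opE x i j :
  conv_op h x (mxvec_index i j) 0 =
  \sum_k \sum_l h k l * x (mxvec_index (i - k) (j - l)) 0.
Proof.
rewrite /conv_op mxE mxvecE mxE; apply: eq_bigr => k _; apply: eq_bigr => l _.
by rewrite !mxE.
Qed.

Lemma conv_op_is_linear : linear (conv_op h).
Proof.
move=> a x y; apply/colP => i; case/mxvec_indexP: i => i j.
rewrite [RHS]mxE [X in _ = X + _]mxE !conv_opE mulr_sumr -big_split.
apply: eq_bigr => k _; rewrite mulr_sumr -big_split; apply: eq_bigr => l _ /=.
by rewrite !mxE mulrDr mulrCA.
Qed.

HB.instance Definition _ :=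
  GRing.isLinear.Build R 'cV[R]_(n1.+1 * n2.+1) 'cV[R]_(n1.+1 * n2.+1)
    _ (conv_op h) conv_op_is_linear.

Lemma conv_op_ge0 x : (forall i j, 0 <= h i j) ->
  nneg_orthant x -> nneg_orthant (conv_op h x).
Proof.
move=> h_ge0 x_ge0 i; case/mxvec_indexP: i => i j; rewrite conv_opE.
by apply: sumr_ge0 => k _; apply: sumr_ge0 => l _; rewrite mulr_ge0.
Qed.

(** Coordinatewise on both sides, so that it chains with [mulmx_coord_continuous] and
    [fidelity_continuous]. *)
Lemma conv_op_continuous (T : topologicalType)
    (x : T -> 'cV[R]_(n1.+1 * n2.+1)) :
  (forall i, continuous (fun t => x t i 0)) ->
  forall i, continuous (fun t => conv_op h (x t) i 0).
Proof.
move=> x_cont i; case/mxvec_indexP: i => i j.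
under eq_fun do rewrite conv_opE.
apply: continuous_sumr => k; apply: continuous_sumr => l t.
by apply: cvgM; [exact: cvg_cst | exact: x_cont].
Qed.

End convolution.

Lemma mulmx_coord_continuous (R : realType) m n (A : 'M[R]_(m, n)) i :
  continuous (fun v : 'cV[R]_n => (A *m v) i 0).
Proof.
under eq_fun do rewrite mxE.
apply: continuous_sumr => j v.
(* Left implicit, the filter gets unified with the unfolding of [nbhs v], for
   which no [Filter] instance is found. *)
by apply: (@cvgMl_tmp _ _ (nbhs v)); exact: coord_continuous.
Qed.

(** * Existence and uniqueness of minimizers over a set of column vectors *)

Section minimization.
Variables (R : realType) (L : nat).
Implicit Types (K : set 'cV[R]_L) (phi : 'cV[R]_L -> R).

Lemma coord_le_enorm (v : 'cV[R]_L) i : `|v i 0| <= enorm v.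
Proof.
rewrite -sqrtr_sqr ler_sqrt; last by apply: sumr_ge0 => j _; exact: sqr_ge0.
rewrite (bigD1 i)//= lerDl; apply: sumr_ge0 => j _; exact: sqr_ge0.
Qed.

Lemma trmx_continuous : continuous (@trmx R 1 L).
Proof.
move=> u A /nbhs_ballP[e e0 eA]; apply/nbhs_ballP; exists e => // v [_ uv].
by apply: eA; split=> // i j; rewrite !mxE; exact: uv.
Qed.

(** [K] is closed in a box that is a product of segments. [rV_compact] speaks of row vectors, so the
    box is built there and carried over by transposition. *)
Lemma closed_bounded_coord_compact K r :
  closed K -> (forall v, K v -> forall i, `|v i 0| <= r) -> compact K.
Proof.
move=> Kclosed Kbounded.
pose box : set 'rV[R]_L := [set u | forall i, `[- r, r]%classic (u ord0 i)].
have box_compact : compact box.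
  apply: (@rV_compact R L (fun=> `[- r, r]%classic)) => _.
  exact: segment_compact.
have cVbox_compact : compact (trmx @` box).
  apply: continuous_compact box_compact.
  exact: continuous_subspaceT trmx_continuous.
apply: subclosed_compact Kclosed cVbox_compact _ => v Kv.
exists v^T; last by rewrite trmxK.
by move=> i; rewrite /= mxE in_itv/= -ler_norml; exact: Kbounded.
Qed.

Lemma coercive_has_min K phi : closed K -> K !=set0 -> continuous phi ->
  coercive (fun v => if v \in K then (phi v)%:E else +oo%E) ->
  exists2 v, K v & forall w, K w -> phi v <= phi w.
Proof.
move=> Kclosed [v0 Kv0] phi_cont phi_coercive.
pose A := K `&` phi @^-1` [set x | x <= phi v0].
have Aclosed : closed A.
  apply: closedI => //; apply: preimage_closed; last exact: closed_le.
  by move=> x _; exact: phi_cont.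
(* Beyond the radius [r] all values exceed [phi v0], which excludes points of [A]. *)
have [r rP] := phi_coercive (phi v0).
have Abounded v : A v -> forall i, `|v i 0| <= r.
  move=> [Kv phiv] i; apply: le_trans (coord_le_enorm v i) _.
  rewrite leNgt; apply/negP => /rP; rewrite mem_set// lte_fin ltNge.
  by move/negP; apply.
have [||v /set_mem[Kv phiv] vmin] := compact_EVT_min _
    (closed_bounded_coord_compact Aclosed Abounded) (f := phi).
- by exists v0; split=> //=.
- exact: continuous_subspaceT.
(* Points of [K] outside [A] have values above [phi v0], hence above [phi v]. *)
exists v => // w Kw; have [phiw|/ltW phiw] := leP (phi w) (phi v0).
  by apply: vmin; apply/mem_set.
exact: le_trans phiv phiw.
Qed.

Lemma strict_midpoint_unique K phi :
  (forall v w, K v -> K w -> K (2^-1 *: (v + w))) ->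
  (forall v w, K v -> K w -> v != w ->
     phi (2^-1 *: (v + w)) < 2^-1 * (phi v + phi w)) ->
  forall v w, K v -> K w -> (forall u, K u -> phi v <= phi u) ->
    (forall u, K u -> phi w <= phi u) -> v = w.
Proof.
move=> Kmid phi_lt v w Kv Kw vmin wmin; apply/eqP/negPn/negP => vw.
have := phi_lt v w Kv Kw vw.
have := vmin _ (Kmid v w Kv Kw); have := wmin _ Kv; have := vmin _ Kw.
lra.
Qed.

End minimization.

(** * The objective on the feasible set *)

Section objective.
Variables (R : realType) (n1 n2 L : nat).
Variables (h : 'M[R]_(n1.+1, n2.+1)) (Phi : 'M[R]_(n1.+1 * n2.+1, L)).
Variables (y : 'I_(n1.+1 * n2.+1) -> nat) (lambda : R) (psi : R -> R).
Implicit Types v w : 'cV[R]_L.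

(** A real-valued function agreeing with J on the feasible set, but defined and studied on the whole
    space. *)
Definition finite_objective v : R :=
  f1 h Phi y v + lambda * \sum_i psi (v i 0).

Lemma objectiveE :
  objective h Phi y lambda psi =
  fun v => if v \in feasible Phi then (finite_objective v)%:E else +oo%E.
Proof.
apply/funext => v; rewrite /objective /f2 /cvx_indicator.
by case: ifP => _; rewrite ?add0e -?EFinD.
Qed.

Lemma feasible0 : feasible Phi 0.
Proof. by move=> i; rewrite mulmx0 mxE. Qed.

Lemma feasible_closed : closed (feasible Phi).
Proof.
rewrite (_ : feasible Phi =
    \bigcap_(i in setT) (fun v => (Phi *m v) i 0) @^-1` [set x | 0 <= x]).
  apply: closed_bigI => i _; apply: preimage_closed; last exact: closed_ge.
  by move=> v _; exact: mulmx_coord_continuous.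
by apply/seteqP; split=> v /= v_ge0 i => [_|]; exact: v_ge0.
Qed.

Lemma feasible_midpoint v w :
  feasible Phi v -> feasible Phi w -> feasible Phi (2^-1 *: (v + w)).
Proof.
move=> v_ge0 w_ge0 i; rewrite -scalemxAr mulmxDr mxE [X in _ * X]mxE.
by rewrite mulr_ge0 ?invr_ge0 ?addr_ge0 ?v_ge0 ?w_ge0.
Qed.

Lemma is_minimizer_objective v :
  is_minimizer (objective h Phi y lambda psi) v <->
  feasible Phi v /\
    forall w, feasible Phi w -> finite_objective v <= finite_objective w.
Proof.
rewrite objectiveE; split=> [vmin|[Kv vmin] w]; last first.
  rewrite (mem_set Kv); case: ifPn => [/set_mem Kw|_]; last exact: leey.
  by rewrite lee_fin vmin.
have Kv : feasible Phi v.
  (* An infeasible [v] has value [+oo], above the finite value at the feasible point 0. *)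
  apply: contrapT => /(@memNset _ _ _) vK.
  by have := vmin 0; rewrite vK (mem_set feasible0).
by split=> // w Kw; have := vmin w; rewrite !mem_set// lee_fin.
Qed.

Hypotheses (h_ge0 : forall i j, 0 <= h i j) (lambda_gt0 : 0 < lambda).
Hypothesis psi_convex : convex_function (E := R^o) setT psi.

Lemma finite_objective_continuous : continuous finite_objective.
Proof.
have f1_cont : continuous (f1 h Phi y).
  apply: fidelity_continuous; apply: conv_op_continuous => i.
  exact: mulmx_coord_continuous.
have reg_cont : continuous (fun v : 'cV[R]_L => \sum_i psi (v i 0)).
  apply: continuous_sumr => i v.
  apply: (@cvg_comp _ _ _ (fun v : 'cV[R]_L => v i 0) psi _ (nbhs (v i 0))).
    exact: coord_continuous.
  exact: convex_function_continuous.
move=> v; apply: (@cvgD _ _ _ (nbhs v)); first exact: f1_cont.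
by apply: (@cvgMl_tmp _ _ (nbhs v)); exact: reg_cont.
Qed.

Let f1_midpointE v w :
  f1 h Phi y (2^-1 *: (v + w)) =
  fidelity y (2^-1 *: (conv_op h (Phi *m v) + conv_op h (Phi *m w))).
Proof. by rewrite /f1 -scalemxAr mulmxDr linearZ linearD. Qed.

(** Since [h] is nonnegative, feasible points are sent into the orthant where the fidelity is
    midpoint convex. *)
Lemma f1_midpoint_le v w : feasible Phi v -> feasible Phi w ->
  f1 h Phi y (2^-1 *: (v + w)) <= 2^-1 * (f1 h Phi y v + f1 h Phi y w).
Proof.
move=> Kv Kw; rewrite f1_midpointE.
by apply: fidelity_midpoint_le; exact: conv_op_ge0.
Qed.

Lemma f1_midpoint_lt v w : feasible Phi v -> feasible Phi w ->
  conv_op h (Phi *m v) != conv_op h (Phi *m w) ->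
  f1 h Phi y (2^-1 *: (v + w)) < 2^-1 * (f1 h Phi y v + f1 h Phi y w).
Proof.
move=> Kv Kw neq; rewrite f1_midpointE.
by apply: fidelity_midpoint_lt neq; exact: conv_op_ge0.
Qed.

Lemma regularizer_midpoint_le v w :
  \sum_i psi ((2^-1 *: (v + w)) i 0) <=
  2^-1 * (\sum_i psi (v i 0) + \sum_i psi (w i 0)).
Proof.
rewrite -big_split mulr_sumr; apply: ler_sum => i _; rewrite !mxE.
exact: convex_function_midpoint.
Qed.

Lemma regularizer_midpoint_lt v w :
  strictly_convex_function (E := R^o) setT psi -> v != w ->
  \sum_i psi ((2^-1 *: (v + w)) i 0) <
  2^-1 * (\sum_i psi (v i 0) + \sum_i psi (w i 0)).
Proof.
move=> psi_strict /cV_neq_coord[i0 neq0].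
rewrite -big_split mulr_sumr; apply: ltr_sum_ex => [i|].
  by rewrite !mxE; exact: convex_function_midpoint.
by exists i0; rewrite !mxE; exact: strictly_convex_function_midpoint.
Qed.

(** Both terms are midpoint convex and [lambda] is positive, so strictness of either one is
    enough. *)
Lemma finite_objective_midpoint_lt v w :
  (orthobasis Phi /\ ker (conv_op h) = [set 0]) \/
    strictly_convex_function (E := R^o) setT psi ->
  feasible Phi v -> feasible Phi w -> v != w ->
  finite_objective (2^-1 *: (v + w)) <
  2^-1 * (finite_objective v + finite_objective w).
Proof.
rewrite /finite_objective => strict Kv Kw vw.
have f1_le := f1_midpoint_le Kv Kw.
have := regularizer_midpoint_le v w; rewrite -(ler_pM2l lambda_gt0) => reg_le.
case: strict => [[[_ PhiTPhi _] kerH]|psi_strict]; last first.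
  have := regularizer_midpoint_lt psi_strict vw.
  by rewrite -(ltr_pM2l lambda_gt0) => reg_lt; lra.
(* Injectivity of H Phi: the trivial kernel cancels the convolution, then the left inverse [Phi^T]
   cancels [Phi]. *)
have : conv_op h (Phi *m v) != conv_op h (Phi *m w).
  apply: contra_neq vw => eq_conv.
  have : ker (conv_op h) (Phi *m v - Phi *m w).
    by rewrite /ker /= linearB /= eq_conv subrr.
  rewrite kerH /= => /subr0_eq eq_Phi.
  by rewrite -[v]mul1mx -[w]mul1mx -PhiTPhi -!mulmxA eq_Phi.
by move=> /(f1_midpoint_lt Kv Kw) f1_lt; lra.
Qed.

End objective.

Theorem proposition2 (R : realType) (n1 n2 L : nat)
  (leqL : (n1.+1 * n2.+1 <= L)%N)
  (h : 'M[R]_(n1.+1, n2.+1)) (h_neq0 : h != 0) (h_ge0 : forall i j, 0 <= h i j)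
  (Phi : 'M[R]_(n1.+1 * n2.+1, L)) (c : R)
  (Phi_unit : forall j, enorm (col j Phi) = 1)
  (Phi_dict : (orthobasis Phi /\ c = 1) \/ tight_frame c Phi)
  (y : 'I_(n1.+1 * n2.+1) -> nat)
  (lambda : R) (lambda_gt0 : 0 < lambda)
  (psi : R -> R) (psi_convex : convex_function (E := R^o) setT psi)
  (J_coercive : coercive (objective h Phi y lambda psi)) :
  (exists alpha, is_minimizer (objective h Phi y lambda psi) alpha) /\
  ((orthobasis Phi /\ ker (conv_op h) = [set 0]) \/
     strictly_convex_function (E := R^o) setT psi ->
   exists! alpha, is_minimizer (objective h Phi y lambda psi) alpha).
Proof.
have [alpha alpha_min] :
    exists alpha, is_minimizer (objective h Phi y lambda psi) alpha.
  have [|||alpha Kalpha alpha_min] := @coercive_has_min R L (feasible Phi)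
      (finite_objective h Phi y lambda psi) (@feasible_closed _ _ _ _ Phi).
  - by exists 0; exact: feasible0.
  - exact: finite_objective_continuous.
  - by rewrite -objectiveE.
  by exists alpha; apply/is_minimizer_objective.
split=> [|strict]; first by exists alpha.
(* Both minimizers are feasible and minimize the real-valued objective, so the midpoint argument
   identifies them. *)
exists alpha; split=> // beta /is_minimizer_objective[Kbeta beta_min].
have /is_minimizer_objective[Kalpha {}alpha_min] := alpha_min.
apply: strict_midpoint_unique Kalpha Kbeta alpha_min beta_min.
  exact: feasible_midpoint.
by move=> v w; exact: finite_objective_midpoint_lt.
Qed.
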